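(* Let $V=V_0+V_1$ with $V_0\in L^\infty(\mathbb{R})$, $\operatorname{ess\,inf}V_0>0$, and $V_1\in\mathcal{M}_1(\mathbb{R})$. Then the function $a\mapsto F(a;V)$ is continuous on $\mathbb{R}$.
   Context: Elements of $H^1(\mathbb{R})$ are identified with their continuous representatives; $\|u\|_\infty:=\|u\|_{L^\infty(\mathbb{R})}$. $\mathcal{M}_1(\mathbb{R})$ is the set of signed Radon measures on $\mathbb{R}$ with finite total variation. The potential $V=V_0+V_1$ acts as the bilinear form $V(u,v):=\int_{\mathbb{R}}V_0uv\,dx+\int_{\mathbb{R}}uv\,dV_1$ on $H^1(\mathbb{R})$, and $I(u;V):=\|u'\|_{L^2(\mathbb{R})}^2+V(u,u)$. For $a\in\mathbb{R}$, $K_a:=\{u\in H^1(\mathbb{R}):u(a)=\|u\|_\infty=1\}$ and $F(a;V):=\inf_{u\in K_a}I(u;V)$. *)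

(* Defs.v *)
From HB Require Import structures.
From mathcomp Require Import all_boot all_order all_algebra.
From mathcomp Require Import all_classical all_reals all_analysis ess_sup_inf.
Set Implicit Arguments. Unset Strict Implicit. Unset Printing Implicit Defensive.
Import Order.TTheory GRing.Theory Num.Theory.
Import numFieldNormedType.Exports.
Local Open Scope classical_set_scope.
Local Open Scope ring_scope.

Section Defs.
Context {R : realType}.

Notation Rm := (measurableTypeR R).
Notation leb := (@lebesgue_measure R).

(* (u, g) : u is the continuous representative of an element of H^1(R) and
   g is its weak derivative u' (in L^2), i.e. u(y) - u(x) = int_x^y g. *)
Definition H1_with_deriv (u g : Rm -> R) : Prop :=
  [/\ continuous (u : R -> R),
      measurable_fun [set: Rm] u /\ measurable_fun [set: Rm] g,
      leb.-integrable [set: Rm] (fun x => ((u x) ^+ 2)%:E),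
      leb.-integrable [set: Rm] (fun x => ((g x) ^+ 2)%:E) &
      (forall x y : R, x <= y ->
         leb.-integrable `[x, y] (fun t => (g t)%:E) /\
         ((u y - u x)%:E = (\int[leb]_(t in `[x, y]) (g t)%:E)%E))].

Definition charge_integral (nu : {charge set Rm -> \bar R}) (f : Rm -> R) : R :=
  let P := projT1 (cid (Hahn_decomposition nu)) in
  let N := projT1 (cid (projT2 (cid (Hahn_decomposition nu)))) in
  let h := projT2 (cid (projT2 (cid (Hahn_decomposition nu)))) in
  Rintegral (jordan_pos h) [set: Rm] f - Rintegral (jordan_neg h) [set: Rm] f.

Definition energy (V0 : Rm -> R) (V1 : {charge set Rm -> \bar R})
    (u g : Rm -> R) : R :=
  Rintegral leb [set: Rm] (fun x => (g x) ^+ 2)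
  + Rintegral leb [set: Rm] (fun x => V0 x * (u x) ^+ 2)
  + charge_integral V1 (fun x => (u x) ^+ 2).

Definition Linf_norm (u : Rm -> R) : \bar R :=
  ess_sup leb (fun x => (`|u x|)%:E).

Definition K_set (a : R) (u : Rm -> R) : Prop :=
  u a = 1 /\ Linf_norm u = 1%:E.

Definition F_fun (V0 : Rm -> R) (V1 : {charge set Rm -> \bar R}) (a : R) : R :=
  inf [set r : R | exists (u g : Rm -> R),
         [/\ H1_with_deriv u g, K_set a u & r = energy V0 V1 u g]].

End Defs.

(* Main.v *)
Require Import Defs.
From HB Require Import structures.
From mathcomp Require Import all_boot all_order all_algebra.
From mathcomp Require Import all_classical all_reals all_analysis measurable_realfun ess_sup_inf.
From mathcomp Require Import ring lra.
Import Order.TTheory GRing.Theory Num.Theory.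
Import numFieldNormedType.Exports.
Local Open Scope classical_set_scope.
Local Open Scope ring_scope.

(* Translation by h maps K_a onto K_(a - h) and keeps the H^1 norm, so it suffices
   to bound the change in energy of a translated competitor u.  Since
   |u(x + h) - u(x)|^2 <= |h| \int u'^2 and |u| <= 1, the V1 term moves by
   O(sqrt |h|); since \int |u(x + h) - u(x)|^2 dx <= 2 h^2 \int u'^2, the V0 term
   moves by O(|h|).  The energy plus the total variation of V1 dominates the H^1
   norm of u, so 1 + |V1|(R) + F(a) changes at most by a factor
   1 + C sqrt |h| when a moves by h, which gives continuity. *)

(** * Translation invariance of Lebesgue measure and of the H^1 structure *)

Section translation.
Context {R : realType}.
Notation Rm := (measurableTypeR R).
Notation leb := (@lebesgue_measure R).

Lemma measurable_shift (h : R) : measurable_fun [set: Rm] (shift h : Rm -> Rm).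
Proof. exact: measurable_funD. Qed.

Let shifted (h : R) : {measure set Rm -> \bar R} :=
  measure_function_pushforward__canonical__measure_function_Measure
    leb (measurable_shift h).

(** By uniqueness of Lebesgue measure it is enough to compare the two measures on half-open
    intervals, and the preimage of []a, b]] is []a - h, b - h]], of the same length. *)
Lemma lebesgue_measure_shift (h : R) (A : set Rm) : measurable A ->
  leb A = pushforward leb (shift h : Rm -> Rm) A.
Proof.
move=> mA; suff mE X : ocitv X -> leb X = shifted h X.
  by exact: (lebesgue_measure_unique mE mA).
move=> [[a b] _ <-] /=.
rewrite /pushforward.
have -> : shift h @^-1` `]a, b] = `]a - h, b - h]%classic.
  by apply/seteqP; split=> x /=; rewrite !in_itv/= ltrBlDr lerBrDr.
rewrite !lebesgue_measure_itv/= !lte_fin ltrD2r.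
by case: ifP => // _; rewrite -!EFinB; congr EFin; ring.
Qed.

Lemma integrable_shift (h : R) (D : set Rm) (f : Rm -> \bar R) :
  measurable D -> leb.-integrable D f ->
  leb.-integrable (shift h @^-1` D) (f \o shift h).
Proof.
move=> mD /integrableP[mf intf]; apply/integrableP; split.
  apply: (measurable_comp mD) => //; last exact: measurable_funTS (measurable_shift h).
  by move=> _ [x Dx <-].
move: intf; congr (_ < _)%E.
(* Passing to [|f|] allows the change of variables for nonnegative functions, which presupposes no
   integrability of the composite. *)
transitivity (\int[shifted h]_(x in D) `|f x|)%E.
  by apply: eq_measure_integral => A mA _; exact: lebesgue_measure_shift.
rewrite ge0_integral_pushforward//; first exact: measurable_shift.
exact: measurableT_comp.
Qed.

Lemma integral_shift (h : R) (D : set Rm) (f : Rm -> \bar R) :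
  measurable D -> measurable_fun [set: Rm] f -> leb.-integrable D f ->
  (\int[leb]_(x in shift h @^-1` D) f (shift h x) = \int[leb]_(x in D) f x)%E.
Proof.
move=> mD mf intf; transitivity (\int[shifted h]_(x in D) f x)%E; last first.
  by apply: eq_measure_integral => A mA _; exact: (esym (lebesgue_measure_shift h A mA)).
by rewrite integral_pushforward//; [exact: measurable_shift|exact: integrable_shift].
Qed.

Lemma H1_with_deriv_shift (h : R) (u g : Rm -> R) :
  H1_with_deriv u g -> H1_with_deriv (u \o shift h) (g \o shift h).
Proof.
move=> [cu [mu mg] u2 g2 ug]; have ms := measurable_shift h.
have shT : [set: Rm] = shift h @^-1` [set: Rm] by [].
split.
- by move=> x; apply: continuous_comp; [apply: cvgD; [exact: cvg_id|exact: cvg_cst]|exact: cu].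
- by split; exact: measurableT_comp.
- by rewrite shT; apply: (integrable_shift h [set: Rm] (fun x => ((u x) ^+ 2)%:E)).
- by rewrite shT; apply: (integrable_shift h [set: Rm] (fun x => ((g x) ^+ 2)%:E)).
move=> x y xy.
have [|intg ugE] := ug (x + h) (y + h); first by rewrite lerD2r.
have sh : `[x, y]%classic = shift h @^-1` `[x + h, y + h] :> set R.
  by apply/seteqP; split=> z /=; rewrite !in_itv/= !lerD2r.
have mxy : measurable (`[x + h, y + h]%classic : set Rm) by exact: measurable_itv.
split.
  by rewrite sh; exact: (integrable_shift h _ (fun t => (g t)%:E)).
rewrite sh/= ugE -(integral_shift h _ (fun t => (g t)%:E))//.
exact/measurable_EFinP.
Qed.

End translation.

(** * Pointwise and mean-square moduli of continuity in H^1 *)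

Section H1_estimates.
Context {R : realType}.
Notation Rm := (measurableTypeR R).
Notation leb := (@lebesgue_measure R).

(* The integral of (g - s)^2 over [x, y] is nonnegative; take for s the mean
   value of g. *)
Lemma H1_sqr_increment (u g : Rm -> R) (x y : R) :
  H1_with_deriv u g -> x <= y ->
  (u y - u x) ^+ 2 <= (y - x) * \int[leb]_(t in `[x, y]) g t ^+ 2.
Proof.
move=> [_ [_ mg] _ g2 ug] xy; have [intg ugE] := ug _ _ xy.
have [->|xney] := eqVneq x y; first by rewrite !subrr expr0n/= mul0r.
have mxy : measurable (`[x, y]%classic : set Rm) by exact: measurable_itv.
have yx : 0 < y - x by rewrite subr_gt0 lt_neqAle xney.
have intg2 : leb.-integrable `[x, y] (EFin \o (fun t => g t ^+ 2)).
  by apply: integrableS g2.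
have lxy : leb `[x, y] = (y - x)%:E.
  by rewrite lebesgue_measure_itv/= lte_fin -subr_gt0 yx -EFinB.
pose s := (u y - u x) / (y - x).
have intc : leb.-integrable `[x, y] (EFin \o cst (s ^+ 2)).
  apply: measurable_bounded_integrable => //.
  - by rewrite [X in (X < _)%E]lxy ltry.
  - by exists `|s ^+ 2|; split=> // M /ltW sM z _.
have intsg : leb.-integrable `[x, y] (EFin \o (fun t => (- (2 * s)) * g t)).
  exact: (integrableZl mxy _ intg).
have : 0 <= \int[leb]_(t in `[x, y]) (g t - s) ^+ 2.
  by apply: Rintegral_ge0 => z _; exact: sqr_ge0.
have -> : \int[leb]_(t in `[x, y]) (g t - s) ^+ 2 =
    \int[leb]_(t in `[x, y]) (g t ^+ 2 + ((- (2 * s)) * g t + s ^+ 2)).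
  by apply: eq_Rintegral => z _; ring.
rewrite RintegralD//; last exact: (integrableD mxy intsg intc).
rewrite RintegralD// RintegralZl// Rintegral_cst//.
rewrite [X in fine X]lxy/=.
have -> : \int[leb]_(t in `[x, y]) g t = u y - u x by rewrite /Rintegral -ugE.
set I := Rintegral _ _ _ => H.
have uE : u y - u x = s * (y - x) by rewrite /s divfK// gt_eqF.
(* As g has integral [s * (y - x)], the cross term of the expanded square is -2 s^2 (y - x).
   Multiplying the result by [y - x] gives the claim. *)
have {}H : 0 <= I - s ^+ 2 * (y - x).
  by move: H; rewrite uE; congr (_ <= _); ring.
by rewrite uE exprMn -subr_ge0; have := mulr_ge0 (ltW yx) H; congr (_ <= _); ring.
Qed.


(** The window symmetric about x serves both signs of h and turns membership into |t - x| <= |h|, a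
    condition symmetric in x and t. Extended real values prepare for Tonelli. *)
Lemma H1_sqr_shift_increment (u g : Rm -> R) (x h : R) :
  H1_with_deriv u g ->
  (((u (x + h) - u x) ^+ 2)%R%:E <=
    `|h|%:E * \int[leb]_(t in `[(x - `|h|)%R, (x + `|h|)%R]) (g t ^+ 2)%R%:E)%E.
Proof.
move=> Hu; have [_ [_ mg] _ g2 _] := Hu.
have mS (a b : R) : measurable (`[a, b]%classic : set Rm) by exact: measurable_itv.
have mg2 : measurable_fun [set: Rm] (fun t => (g t ^+ 2)%R%:E).
  by apply/measurable_EFinP; exact: measurable_funX.
have int_g2 (a b : R) : leb.-integrable `[a, b] (fun t => (g t ^+ 2)%R%:E).
  by apply: integrableS g2.
(* Here a and b stand for x and x + h in increasing order. *)
have key a b : a <= b -> b - a = `|h| -> (u (x + h) - u x) ^+ 2 = (u b - u a) ^+ 2 ->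
    x - `|h| <= a -> b <= x + `|h| ->
    (((u (x + h) - u x) ^+ 2)%R%:E <=
      `|h|%:E * \int[leb]_(t in `[(x - `|h|)%R, (x + `|h|)%R]) (g t ^+ 2)%R%:E)%E.
  move=> ab bah -> xa bx.
  apply: (@le_trans _ _ (`|h|%:E * \int[leb]_(t in `[a, b]) (g t ^+ 2)%R%:E)%E).
    rewrite -[X in (_ * X)%E]fineK; last exact: integrable_fin_num.
    by rewrite -EFinM lee_fin -bah; exact: H1_sqr_increment.
  apply: lee_wpmul2l; first by rewrite lee_fin.
  apply: ge0_subset_integral => //.
  - exact: measurable_funTS.
  - by move=> t _; rewrite lee_fin sqr_ge0.
  - by apply: subset_itv; rewrite bnd_simp.
have [h0|h0] := leP 0 h.
  by apply: (key x (x + h)); rewrite ?ger0_norm//; lra.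
by apply: (key (x + h) x); rewrite ?ltr0_norm//; try lra; ring.
Qed.

(* By Tonelli, integrating over x the energy of g on [x - |h|, x + |h|] counts
   each g(t)^2 with weight 2|h|. *)
Lemma H1_L2_modulus (u g : Rm -> R) (h : R) : H1_with_deriv u g ->
  (\int[leb]_x (((u (x + h) - u x) ^+ 2)%R%:E) <=
    (2 * `|h| ^+ 2)%R%:E * \int[leb]_t (g t ^+ 2)%R%:E)%E.
Proof.
move=> Hu; have [_ [mu mg] _ g2 _] := Hu.
have mg2 : measurable_fun [set: Rm] (fun t => (g t ^+ 2)%R%:E).
  by apply/measurable_EFinP; exact: measurable_funX.
have mS (a b : R) : measurable (`[a, b]%classic : set Rm) by exact: measurable_itv.
pose k := `|h|; have k0 : 0 <= k by exact: normr_ge0.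
(* The moving window is written as a fixed indicator evaluated at t - x, which makes joint
   measurability immediate. *)
pose f (p : Rm * Rm) : \bar R :=
  ((\1_(`[- k, k]%classic : set Rm) (p.2 - p.1)%R : R)%:E * (g p.2 ^+ 2)%R%:E)%E.
have f0 p : (0 <= f p)%E by rewrite /f mule_ge0// lee_fin sqr_ge0.
have mf : measurable_fun [set: Rm * Rm] f.
  apply: emeasurable_funM; last exact: (measurableT_comp mg2 measurable_snd).
  apply/measurable_EFinP; apply: measurableT_comp => //.
  by apply: measurable_funB.
apply: (@le_trans _ _ (\int[leb]_x (k%:E * \int[leb]_t f (x, t)))%E).
  apply: ge0_le_integral => //.
  - by move=> x _; rewrite lee_fin sqr_ge0.
  - apply/measurable_EFinP; apply: measurable_funX; apply: measurable_funB => //.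
    by apply: measurableT_comp => //; exact: measurable_shift.
  - by apply: measurable_funeM; exact: (measurable_fun_fubini_tonelli_F f).
  move=> x _; apply: le_trans (H1_sqr_shift_increment _ _ x h Hu) _.
  rewrite -/k integral_mkcond; apply: lee_wpmul2l => //.
  rewrite le_eqVlt; apply/orP; left; apply/eqP; apply: eq_integral => t _.
  rewrite epatch_indic /f/= muleC; congr (_%:E * _)%E.
  rewrite !indicE; congr (_%:R); congr nat_of_bool.
  by apply/idP/idP; rewrite !inE/= !in_itv/=; lra.
rewrite ge0_integralZl_EFin//; last 2 first.
- by move=> x _; exact: integral_ge0.
- exact: (measurable_fun_fubini_tonelli_F f).
rewrite fubini_tonelli//.
have -> : (\int[leb]_t \int[leb]_x f (x, t) =
    \int[leb]_t ((2 * k)%R%:E * (g t ^+ 2)%R%:E))%E.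
  apply: eq_integral => t _; rewrite /f/=.
  have fE : (fun x : Rm => (\1_(`[- k, k]%classic : set Rm) (t - x)%R : R)%:E) =
      EFin \o \1_(`[(t - k)%R, (t + k)%R]%classic : set Rm).
    apply/funext => x/=; rewrite !indicE; congr (_%:R%:E); congr nat_of_bool.
    by apply/idP/idP; rewrite !inE/= !in_itv/=; lra.
  rewrite ge0_integralZr//.
  - rewrite fE integral_indic// setIT [X in (X * _)%E]lebesgue_measure_itv/= lte_fin.
    (* The length formula tests t - k < t + k; failure of this test forces k = 0, where both sides
       vanish. *)
    case: ltP => [_|tk]; first by rewrite -EFinB; congr (_%:E * _)%E; ring.
    by have -> : k = 0 by [lra]; rewrite mulr0.
  - by rewrite fE; apply/measurable_EFinP; exact: measurable_indic.
  - by rewrite lee_fin sqr_ge0.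
rewrite ge0_integralZl_EFin//; last 2 first.
- by move=> x _; rewrite lee_fin sqr_ge0.
- by rewrite mulr_ge0.
by rewrite muleA -EFinM (_ : (k * (2 * k) = 2 * `|h| ^+ 2)%R)// /k; ring.
Qed.

End H1_estimates.

(** * The constraint set K_a, and integrals of bounded functions against a charge *)

Section bounded_continuous.
Context {R : realType}.
Notation Rm := (measurableTypeR R).
Notation leb := (@lebesgue_measure R).

(** Otherwise some real r with [Linf_norm u <= r] is exceeded by |u| at x, hence by continuity on a
    whole ball; that ball would be Lebesgue-null, although its radius is positive. *)
Lemma continuous_le_Linf_norm (u : Rm -> R) (x : R) :
  continuous (u : R -> R) -> ((`|u x|)%:E <= Linf_norm u)%E.
Proof.
move=> cu; rewrite leNgt; apply/negP => Lx.
have [r Lr rx] : exists2 r : R, (Linf_norm u <= r%:E)%E & r < `|u x|.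
  move: Lx; case: (Linf_norm u) => [r| |]//.
    by rewrite lte_fin => rx; exists r.
  by exists (`|u x| - 1); rewrite ?leNye//; lra.
have /ess_supP aer := Lr.
have [e /= e0 eb] : nbhs (x : R) [set z : R | r < `|u z|].
  have /cvg_norm cx := cu x.
  exact: (cvgr_gt _ cx _ rx).
have mball : measurable (ball (x : R) e : set Rm) by exact: measurable_ball.
have ball0 : leb (ball (x : R) e) = 0%E.
  have [N [mN N0 subN]] := aer.
  apply: (@subset_measure0 _ _ _ leb (ball (x : R) e) N) => //.
  move=> z xez; apply: subN => /=; apply/negP; rewrite -ltNge lte_fin.
  exact: eb.
by move: ball0; rewrite lebesgue_measure_ball ?ltW// => -[]; lra.
Qed.

(** Makes the norm constraint pointwise. Conversely, |u| <= 1 bounds the essential supremum above,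
    and continuity with u(a) = 1 bounds it below. *)
Lemma K_setP (a : R) (u : Rm -> R) : continuous (u : R -> R) ->
  K_set a u <-> u a = 1 /\ forall x, `|u x| <= 1.
Proof.
move=> cu; split=> -[ua].
  by move=> L1; split=> // x; rewrite -lee_fin -L1; exact: continuous_le_Linf_norm.
move=> u1; split=> //; apply/eqP; rewrite eq_le; apply/andP; split.
  by apply/ess_supP; apply: nearW => x; rewrite lee_fin.
by apply: le_trans (continuous_le_Linf_norm u a cu); rewrite ua normr1.
Qed.

Lemma K_set_shift (a h : R) (u : Rm -> R) : continuous (u : R -> R) ->
  K_set a u -> K_set (a - h) (u \o shift h).
Proof.
move=> cu /(K_setP _ _ cu)[ua u1].
have cuh : continuous (u \o shift h : R -> R).
  by move=> x; apply: continuous_comp; [apply: cvgD; [exact: cvg_id|exact: cvg_cst]|exact: cu].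
by apply/(K_setP _ _ cuh); split=> [|x]; [rewrite /= subrK|exact: u1].
Qed.

Lemma le_normr_Rintegral_bounded (mu : {finite_measure set Rm -> \bar R})
    (f : Rm -> R) (M : R) : measurable_fun [set: Rm] f -> (forall x, `|f x| <= M) ->
  mu.-integrable [set: Rm] (EFin \o f) /\
  `|\int[mu]_x f x| <= M * fine (mu [set: Rm]).
Proof.
move=> mf fM.
have muT : (mu [set: Rm] < +oo)%E by rewrite ltey_eq fin_num_measure.
have bdd (k : Rm -> R) : (forall x, `|k x| <= M) -> [bounded k x | x in [set: Rm]].
  by move=> kM; exists M; split=> [|N /ltW MN x _]; [exact: num_real|exact: le_trans (kM x) _].
have intf : mu.-integrable [set: Rm] (EFin \o f).
  by apply: measurable_bounded_integrable => //; exact: bdd.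
split=> //; apply: le_trans (le_normr_Rintegral _ intf) _ => //.
rewrite -Rintegral_cst//; apply: le_Rintegral => //.
  apply: measurable_bounded_integrable => //; first exact: measurableT_comp.
  by apply: bdd => x; rewrite normr_id.
exact: finite_measure_integrable_cst.
Qed.

(** The witness is the total variation of [nu], the sum of the masses of its Jordan parts. In the
    second estimate M serves to make both functions integrable, so that the first estimate applies
    to their difference. *)
Lemma charge_integral_bounded (nu : {charge set Rm -> \bar R}) :
  exists2 N : R, 0 <= N &
  (forall (f : Rm -> R) (M : R), measurable_fun [set: Rm] f ->
    (forall x, `|f x| <= M) -> `|charge_integral nu f| <= M * N) /\
  (forall (f1 f2 : Rm -> R) (M e : R), measurable_fun [set: Rm] f1 ->
    measurable_fun [set: Rm] f2 ->
    (forall x, `|f1 x| <= M) -> (forall x, `|f2 x| <= M) ->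
    (forall x, `|f1 x - f2 x| <= e) ->
    `|charge_integral nu f1 - charge_integral nu f2| <= e * N).
Proof.
rewrite /charge_integral.
set h := projT2 (cid (projT2 (cid (Hahn_decomposition nu)))).
pose p : {finite_measure set Rm -> \bar R} := jordan_pos h.
pose n : {finite_measure set Rm -> \bar R} := jordan_neg h.
exists (fine (p [set: Rm]) + fine (n [set: Rm])).
  by rewrite addr_ge0// fine_ge0.
have bound (f : Rm -> R) (M : R) : measurable_fun [set: Rm] f ->
    (forall x, `|f x| <= M) ->
    `|\int[p]_x f x - \int[n]_x f x| <= M * (fine (p [set: Rm]) + fine (n [set: Rm])).
  move=> mf fM; apply: le_trans (ler_normB _ _) _; rewrite mulrDr.
  by apply: lerD; apply: (le_normr_Rintegral_bounded _ _ _ mf fM).2.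
split; first exact: bound.
move=> f1 f2 M e mf1 mf2 f1M f2M f12.
have mf12 : measurable_fun [set: Rm] (f1 \- f2) by exact: measurable_funB.
apply: le_trans (bound (f1 \- f2) e mf12 f12).
rewrite !RintegralB//; try by apply: (le_normr_Rintegral_bounded _ _ _ mf1 f1M).1.
- by rewrite le_eqVlt; apply/orP; left; apply/eqP; congr `|_|; rewrite /p /n; ring.
- exact: (le_normr_Rintegral_bounded _ _ _ mf2 f2M).1.
- exact: (le_normr_Rintegral_bounded _ _ _ mf2 f2M).1.
Qed.

End bounded_continuous.

(** * Effect of a translation on the term of a bounded potential *)

Section potential.
Context {R : realType}.
Notation Rm := (measurableTypeR R).
Notation leb := (@lebesgue_measure R).

Lemma Rintegral_shift (h : R) (f : Rm -> R) : measurable_fun [set: Rm] f ->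
  leb.-integrable [set: Rm] (EFin \o f) ->
  \int[leb]_x f (x + h) = \int[leb]_x f x.
Proof.
move=> mf intf; rewrite /Rintegral -(integral_shift h [set: Rm] (EFin \o f))//.
exact/measurable_EFinP.
Qed.

(* |p^2 - q^2| <= (p - q)^2 / (2 |h|) + |h| (p^2 + q^2); the first term is
   controlled by the L^2 modulus of continuity. *)
Lemma potential_shift (W u g : Rm -> R) (B h : R) :
  measurable_fun [set: Rm] W -> (forall x, `|W x| <= B) -> H1_with_deriv u g ->
  `|\int[leb]_x (W x * u (x + h) ^+ 2) - \int[leb]_x (W x * u x ^+ 2)| <=
    B * `|h| * (\int[leb]_x (g x ^+ 2) + 2 * \int[leb]_x (u x ^+ 2)).
Proof.
move=> mW WB Hu; have [_ [mu mg] u2 g2 _] := Hu.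
(* The bound used below divides by |h|. *)
have [->|h0] := eqVneq h 0.
  rewrite normr0 mulr0 mul0r normr_le0 subr_eq0; apply/eqP.
  by apply: eq_Rintegral => x _; rewrite addr0.
have B0 : 0 <= B := le_trans (normr_ge0 _) (WB 0).
have [_ [muh _] uh2 _ _] := H1_with_deriv_shift h u g Hu.
pose uh : Rm -> R := u \o shift h.
have mu2 : measurable_fun [set: Rm] (fun x => u x ^+ 2) by exact: measurable_funX.
have muh2 : measurable_fun [set: Rm] (fun x => uh x ^+ 2) by exact: measurable_funX.
have intW (v : Rm -> R) : measurable_fun [set: Rm] (fun x => v x ^+ 2) ->
    leb.-integrable [set: Rm] (fun x => (v x ^+ 2)%:E) ->
    leb.-integrable [set: Rm] (EFin \o (fun x => W x * v x ^+ 2)).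
  move=> mv v2; apply: (le_integrable measurableT (g := fun x => (B * v x ^+ 2)%:E)).
  - by apply/measurable_EFinP; exact: measurable_funM.
  - move=> x _; rewrite lee_fin !normrM ler_wpM2r//.
    by rewrite (ger0_norm B0).
  - exact: (integrableZl measurableT B v2).
have intD : leb.-integrable [set: Rm] (EFin \o (fun x => uh x ^+ 2 + u x ^+ 2)).
  exact: (integrableD measurableT uh2 u2).
(* Dominated through (p - q)^2 <= 2 (p^2 + q^2), where the gap is (p + q)^2. *)
have intd : leb.-integrable [set: Rm] (EFin \o (fun x => (uh x - u x) ^+ 2)).
  apply: (le_integrable measurableT _ _
    (integrableZl measurableT 2 intD)).
  - by apply/measurable_EFinP; apply: measurable_funX; exact: measurable_funB.
  - move=> x _; rewrite lee_fin !ger0_norm ?sqr_ge0//.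
      by rewrite -subr_ge0 (_ : _ - _ = (uh x + u x) ^+ 2) ?sqr_ge0//; ring.
    by rewrite mulr_ge0// addr_ge0// sqr_ge0.
set G := \int[leb]_x (g x ^+ 2); set U := \int[leb]_x (u x ^+ 2).
have modulus : \int[leb]_x ((uh x - u x) ^+ 2) <= 2 * `|h| ^+ 2 * G.
  rewrite -lee_fin EFinM /G /Rintegral !fineK; last 2 first.
  - exact: (integrable_fin_num measurableT g2).
  - exact: (integrable_fin_num measurableT intd).
  exact: (H1_L2_modulus u g h Hu).
have uhU : \int[leb]_x (uh x ^+ 2) = U by exact: Rintegral_shift.
rewrite -RintegralB//; [|exact: (intW uh)|exact: (intW u)].
have intWd := integrableB measurableT (intW uh muh2 uh2) (intW u mu2 u2).
apply: le_trans (le_normr_Rintegral measurableT intWd) _.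
(* The weights balance: with the modulus 2 |h|^2 G the first term integrates to at most B |h| G, and
   the second to 2 B |h| U. *)
pose bnd x := B / (2 * `|h|) * (uh x - u x) ^+ 2 + B * `|h| * (uh x ^+ 2 + u x ^+ 2).
have h0' : 0 < `|h| by rewrite normr_gt0.
have int1 := integrableZl measurableT (B / (2 * `|h|)) intd.
have int2 := integrableZl measurableT (B * `|h|) intD.
apply: (@le_trans _ _ (\int[leb]_x bnd x)).
  apply: le_Rintegral => //.
  - exact: (integrable_abse intWd).
  - exact: (integrableD measurableT int1 int2).
  move=> x _; rewrite -/(uh x) -mulrBr normrM.
  apply: (@le_trans _ _ (B * `|uh x ^+ 2 - u x ^+ 2|)); first by rewrite ler_wpM2r.
  rewrite /bnd -mulrA -[B * `|h| * _]mulrA -mulrDr; apply: ler_wpM2l => //.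
  set p := uh x; set q := u x; set k := `|h|.
  rewrite invfM; set i := k^-1; have i0 : 0 <= i by rewrite invr_ge0 ltW.
  (* The two signs s give the absolute value. The gap between the two sides is exactly the sum of
     squares below, because (p + q)^2 + (p - q)^2 = 2 (p^2 + q^2). *)
  have key (s : R) : s = 1 \/ s = -1 -> s * (p ^+ 2 - q ^+ 2) <=
      2^-1 * i * (p - q) ^+ 2 + k * (p ^+ 2 + q ^+ 2).
    move=> s1.
    have : 0 <= 2^-1 * i * (p - q - k * s * (p + q)) ^+ 2 + 2^-1 * k * (p - q) ^+ 2.
      by rewrite addr_ge0// mulr_ge0 ?sqr_ge0// mulr_ge0 ?invr_ge0// ltW.
    move=> H; rewrite -subr_ge0; apply: le_trans H _; rewrite le_eqVlt; apply/orP; left; apply/eqP.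
    by case: s1 => ->; rewrite /i; field; rewrite gt_eqF.
  by rewrite ler_norml; have := key 1 (or_introl erefl); have := key (-1) (or_intror erefl); lra.
rewrite RintegralD//.
rewrite RintegralZl// RintegralZl// RintegralD// uhU -/U.
apply: (@le_trans _ _ (B / (2 * `|h|) * (2 * `|h| ^+ 2 * G) + B * `|h| * (U + U))).
  by rewrite lerD2r; apply: ler_wpM2l => //; rewrite divr_ge0// mulr_ge0.
by rewrite le_eqVlt; apply/orP; left; apply/eqP; field; rewrite normr_eq0.
Qed.

End potential.

(** * Energy of translated competitors and continuity of F *)

Section continuity.
Context {R : realType}.
Notation Rm := (measurableTypeR R).
Notation leb := (@lebesgue_measure R).

(** Truncating V at its essential bounds changes it only on a null set and makes the bounds hold
    everywhere. The outer maximum with c keeps the lower bound whatever the value of B. *)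
Lemma ess_bounded_version (V : Rm -> R) : measurable_fun [set: Rm] V ->
  (ess_sup leb (fun x => (`|V x|)%:E) < +oo)%E ->
  (0 < ess_inf leb (fun x => (V x)%:E))%E ->
  exists (W : Rm -> R) (B c : R), [/\ measurable_fun [set: Rm] W, 0 < c,
    forall x, c <= W x <= B & \forall x \ae leb, V x = W x].
Proof.
move=> mV supV infV.
have [B supB] : exists B : R, (ess_sup leb (fun x => (`|V x|)%:E) <= B%:E)%E.
  move: supV; case: (ess_sup _ _) => [r| |]//; first by exists r.
  by exists 0; rewrite leNye.
have [c c0 cinf] : exists2 c : R, 0 < c & (c%:E <= ess_inf leb (fun x => (V x)%:E))%E.
  move: infV; case: (ess_inf _ _) => [r| |]//; first by rewrite lte_fin; exists r.
  by exists 1; rewrite ?leey.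
exists (fun x => Num.max c (Num.min (V x) B)), (Num.max c B), c; split=> //.
- by apply: measurable_maxr => //; exact: measurable_minr.
- move=> x; apply/andP; split; first by rewrite le_max lexx.
  rewrite ge_max le_max lexx/=; apply: (@le_trans _ _ B).
    by rewrite ge_min lexx orbT.
  by rewrite le_max lexx orbT.
move/ess_supP : supB => supB; move/ess_infP : cinf => infc.
near=> x.
have : (`|V x|%:E <= B%:E)%E by near: x.
have : (c%:E <= (V x)%:E)%E by near: x.
rewrite !lee_fin => cV VB; rewrite min_l; last exact: le_trans (ler_norm _) VB.
by rewrite max_r.
Unshelve. all: by end_near. Qed.

(** Only the Lebesgue term sees the potential; the charge may have mass on null sets, but it
    integrates the same u^2 on both sides. *)
Lemma energy_ae_eq (V W : Rm -> R) (nu : {charge set Rm -> \bar R}) (u g : Rm -> R) :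
  measurable_fun [set: Rm] V -> measurable_fun [set: Rm] W ->
  measurable_fun [set: Rm] u -> (\forall x \ae leb, V x = W x) ->
  energy V nu u g = energy W nu u g.
Proof.
move=> mV mW mu VW; rewrite /energy; congr (_ + _ + _); congr fine.
have mint (f : Rm -> R) : measurable_fun [set: Rm] f ->
    measurable_fun [set: Rm] (fun x => (f x * u x ^+ 2)%:E).
  by move=> mf; apply/measurable_EFinP; apply: measurable_funM => //; exact: measurable_funX.
apply: ae_eq_integral; [exact: measurableT|exact: mint|exact: mint|].
by apply: filterS VW => x + _ => ->.
Qed.

(** Since |u| <= 1, the charge term is at least -N, so N + energy dominates both the integral of g^2
    and c times that of u^2. The translation errors are thus controlled by the energy itself, with
    constants independent of u. *)
Lemma energy_shift_le (W : Rm -> R) (B c : R) (nu : {charge set Rm -> \bar R}) :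
  measurable_fun [set: Rm] W -> 0 < c -> (forall x, c <= W x <= B) ->
  exists N C : R, 0 <= C /\
    forall (u g : Rm -> R) (a : R), H1_with_deriv u g -> K_set a u ->
      0 <= N + energy W nu u g /\
      forall h, `|h| <= 1 ->
        energy W nu (u \o shift h) (g \o shift h) <=
        energy W nu u g + C * Num.sqrt `|h| * (1 + (N + energy W nu u g)).
Proof.
move=> mW c0 cWB; have [N N0 [chB chL]] := charge_integral_bounded nu.
have WB x : `|W x| <= B.
  by have /andP[cW WB] := cWB x; rewrite ger0_norm// (le_trans (ltW c0)).
have B0 : 0 <= B := le_trans (normr_ge0 _) (WB 0).
(* In the second constant, [B * (1 + 2 / c)] comes from the potential term, as G + 2 U <= (1 + 2 /
   c) r, and N from the charge term. *)
exists N, (B * (1 + 2 / c) + N); split.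
  by rewrite addr_ge0// mulr_ge0// addr_ge0// divr_ge0// ltW.
move=> u g a Hu Ku; have [cu [mu mg] u2 g2 _] := Hu.
have [_ u1] := (K_setP a u cu).1 Ku.
pose G := \int[leb]_x (g x ^+ 2); pose U := \int[leb]_x (u x ^+ 2).
pose P := \int[leb]_x (W x * u x ^+ 2).
pose ch := charge_integral nu (fun x => u x ^+ 2).
have G0 : 0 <= G by apply: Rintegral_ge0 => x _; exact: sqr_ge0.
have U0 : 0 <= U by apply: Rintegral_ge0 => x _; exact: sqr_ge0.
have mu2 : measurable_fun [set: Rm] (fun x => u x ^+ 2) by exact: measurable_funX.
have mg2 : measurable_fun [set: Rm] (fun x => g x ^+ 2) by exact: measurable_funX.
have sqr1 (v : Rm -> R) : (forall x, `|v x| <= 1) -> forall x, `|v x ^+ 2| <= 1.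
  by move=> v1 x; rewrite normrX expr_le1.
have chN : - N <= ch.
  have := chB (fun x => u x ^+ 2) 1 mu2 (sqr1 u u1).
  by rewrite mul1r ler_norml => /andP[].
have PU : c * U <= P.
  rewrite -RintegralZl//; apply: le_Rintegral => //.
  - exact: (integrableZl measurableT c u2).
  - apply: (le_integrable measurableT _ _ (integrableZl measurableT B u2)).
      by apply/measurable_EFinP; exact: measurable_funM.
    move=> x _; rewrite lee_fin !normrM ler_wpM2r//.
    by rewrite (ger0_norm B0).
  - by move=> x _; rewrite ler_wpM2r ?sqr_ge0//; case/andP: (cWB x).
have eE : energy W nu u g = G + P + ch by [].
have cU0 : 0 <= c * U by rewrite mulr_ge0// ltW.
rewrite eE; set r := N + _.
have Gr : G <= r by rewrite /r; lra.
have Ur : U <= r / c by rewrite ler_pdivlMr// mulrC /r; lra.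
have r0 : 0 <= r := le_trans G0 Gr.
split=> // h h1; set k := Num.sqrt `|h|.
have k0 : 0 <= k by exact: sqrtr_ge0.
have k2 : `|h| = k ^+ 2 by rewrite sqr_sqrtr.
have k1 : k <= 1 by rewrite -sqrtr1 ler_wsqrtr.
have muh : measurable_fun [set: Rm] (u \o shift h).
  by apply: measurableT_comp => //; exact: measurable_shift.
have GhE : \int[leb]_x (g (x + h) ^+ 2) = G by exact: Rintegral_shift.
have Ph := potential_shift W u g B h mW WB Hu.
(* As |u| <= 1, the left side is at most 2 |u(x + h) - u(x)| <= 2 k sqrt G, and 4 G <= (1 + G)^2
   removes the root of G. *)
have incr x : `|u (x + h) ^+ 2 - u x ^+ 2| <= k * (1 + G).
  have dG : (u (x + h) - u x) ^+ 2 <= `|h| * G.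
    rewrite -lee_fin [leRHS]EFinM; apply: le_trans (H1_sqr_shift_increment u g x h Hu) _.
    apply: lee_wpmul2l; first by rewrite lee_fin.
    rewrite /G /Rintegral fineK; last exact: (integrable_fin_num measurableT g2).
    apply: ge0_subset_integral => //; first exact/measurable_EFinP.
    by move=> t _; rewrite lee_fin sqr_ge0.
  apply: (@le_trans _ _ (`|u (x + h) - u x| * 2)).
    rewrite subr_sqr normrM ler_wpM2l//.
    by apply: le_trans (ler_normD _ _) _; have := u1 (x + h); have := u1 x; lra.
  rewrite -ler_sqr ?nnegrE ?mulr_ge0// ?addr_ge0//.
  rewrite !exprMn -normrX ger0_norm ?sqr_ge0//.
  apply: (@le_trans _ _ (`|h| * G * 2 ^+ 2)); first by rewrite ler_wpM2r.
  rewrite k2 -mulrA ler_wpM2l ?sqr_ge0//.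
  by rewrite -subr_ge0 (_ : _ - _ = (1 - G) ^+ 2) ?sqr_ge0//; ring.
have chD : `|charge_integral nu (fun x => u (x + h) ^+ 2) - ch| <= k * (1 + G) * N.
  apply: (chL _ _ 1) => //.
  - exact: (measurable_funX _ muh).
  - by apply: (sqr1 (u \o shift h)) => x; exact: u1.
  - exact: sqr1.
rewrite /energy/= GhE.
have /ler_normlP[_ {}Ph] := Ph; have /ler_normlP[_ {}chD] := chD.
rewrite -/P -/G -/U k2 in Ph.
have GU : G + 2 * U <= (1 + 2 / c) * r.
  by have -> : (1 + 2 / c) * r = r + 2 * (r / c) by [ring]; lra.
(* The potential error is of order |h| = k^2; k <= 1 degrades it to order k, to match the charge
   error. *)
have step1 : B * k ^+ 2 * (G + 2 * U) <= k * (B * (1 + 2 / c)) * (1 + r).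
  apply: (@le_trans _ _ (B * k * ((1 + 2 / c) * (1 + r)))); last first.
    by rewrite le_eqVlt; apply/orP; left; apply/eqP; ring.
  apply: ler_pM => //; rewrite ?mulr_ge0 ?sqr_ge0 ?addr_ge0 ?mulr_ge0//.
    by rewrite expr2 mulrA ler_piMr// mulr_ge0.
  apply: le_trans GU _; rewrite ler_wpM2l ?lerDr//.
  by rewrite addr_ge0// divr_ge0// ltW.
have step2 : k * (1 + G) * N <= k * N * (1 + r).
  rewrite [leRHS]mulrAC; apply: ler_wpM2r => //; apply: ler_wpM2l => //; lra.
rewrite -/ch -/P.
have -> : (B * (1 + 2 / c) + N) * k * (1 + r) =
    k * (B * (1 + 2 / c)) * (1 + r) + k * N * (1 + r) by ring.
lra.
Qed.

(** Applying the bound from a to b and from b to a controls both signs of f b - f a. One of these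
    carries the factor f b, which is first replaced by (1 + C) f a; hence the constant K. *)
Lemma continuous_of_sqrt_modulus (f : R -> R) (C : R) : 0 <= C ->
  (forall a, 0 <= f a) ->
  (forall a b, `|b - a| <= 1 -> f b <= (1 + C * Num.sqrt `|b - a|) * f a) ->
  continuous f.
Proof.
move=> C0 f0 fC a; pose K := C * (1 + C) * f a.
have cs : {for a, continuous (fun b : R => Num.sqrt `|a - b|)}.
  apply: (@continuous_comp _ _ _ (fun b : R => `|a - b|) Num.sqrt).
    by apply: cvg_norm; apply: cvgB; [exact: cvg_cst|exact: cvg_id].
  exact: sqrt_continuous.
have cK : K * Num.sqrt `|a - b| @[b --> a] --> (0 : R).
  have -> : (0 : R) = K * Num.sqrt `|a - a| by rewrite subrr normr0 sqrtr0 mulr0.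
  by apply: cvgM; [exact: cvg_cst|exact: cs].
apply/cvgrPdist_le => e e0; near=> b.
have ab1 : `|a - b| <= 1.
  by apply: ltW; near: b; exact: (nbhsx_ballx (a : R) (1 : R) ltr01).
have Ke : K * Num.sqrt `|a - b| <= e.
  near: b; exact: (cvgr_le _ cK _ e0).
apply: le_trans Ke.
have h1 := fC b a ab1; have h2 := fC a b; rewrite distrC in h2; have {}h2 := h2 ab1.
set k := Num.sqrt _ in h1 h2 *.
have k0 : 0 <= k by exact: sqrtr_ge0.
have k1 : k <= 1 by rewrite -sqrtr1 ler_wsqrtr.
have fab : f b <= (1 + C) * f a.
  apply: le_trans h2 _; apply: ler_wpM2r => //.
  by rewrite lerD2l ler_piMr.
have Ck0 : 0 <= C * k by rewrite mulr_ge0.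
have g1 : C * k * f b <= C * k * ((1 + C) * f a) by rewrite ler_wpM2l.
have g2 : C * k * f a <= C * k * ((1 + C) * f a).
  by rewrite ler_wpM2l// mulrDl mul1r lerDl mulr_ge0.
rewrite (_ : K * k = C * k * ((1 + C) * f a)); last by rewrite /K; ring.
by rewrite ler_norml; lra.
Unshelve. all: by end_near. Qed.

End continuity.

Theorem theorem5p5 (R : realType) (V0 : measurableTypeR R -> R)
    (V1 : {charge set measurableTypeR R -> \bar R}) :
  measurable_fun [set: measurableTypeR R] V0 ->
  (ess_sup (@lebesgue_measure R) (fun x => (`|V0 x|)%:E) < +oo)%E ->
  (0 < ess_inf (@lebesgue_measure R) (fun x => (V0 x)%:E))%E ->
  continuous (F_fun V0 V1 : R -> R).
Proof.
move=> mV supV infV.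
(* All energies are compared through the truncated W, which gives the same values as V0. *)
have [W [B [c [mW c0 cWB VW]]]] := ess_bounded_version V0 mV supV infV.
have [N [C [C0 shiftW]]] := energy_shift_le W B c V1 mW c0 cWB.
pose E (a : R) : set R := [set r : R | exists u g : measurableTypeR R -> R,
  [/\ H1_with_deriv u g, K_set a u & r = energy V0 V1 u g]].
have E_shift a b r : E a r -> `|b - a| <= 1 ->
    exists2 r', E b r' & r' <= r + C * Num.sqrt `|b - a| * (1 + (N + r)).
  move=> [u [g [Hu Ku ->]]]; rewrite distrC => ba.
  have [cu [mu _] _ _ _] := Hu.
  (* Shifting by a - b moves the peak from a to a - (a - b) = b. *)
  have Hu' := H1_with_deriv_shift (a - b) u g Hu.
  have [_ [mu' _] _ _ _] := Hu'.
  rewrite (energy_ae_eq V0 W)//.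
  exists (energy W V1 (u \o shift (a - b)) (g \o shift (a - b))).
    exists (u \o shift (a - b)), (g \o shift (a - b)); split=> //.
      by have := K_set_shift a (a - b) u cu Ku; rewrite subKr.
    by rewrite (energy_ae_eq V0 W).
  exact: (shiftW u g a Hu Ku).2.
have E_lb a r : E a r -> - N <= r.
  move=> [u [g [Hu Ku ->]]]; have [_ [mu _] _ _ _] := Hu.
  rewrite (energy_ae_eq V0 W)//; have [+ _] := shiftW u g a Hu Ku; lra.
have FE a : F_fun V0 V1 a = inf (E a) by [].
(* Translates show that if some E a is empty then all are, and inf set0 = 0. *)
have [[a0 [r0 Ea0]]|E0] := pselect (exists a, E a !=set0); last first.
  have F0 a : F_fun V0 V1 a = 0.
    rewrite FE (_ : E a = set0) ?inf0//; apply/seteqP; split=> // r Er.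
    by apply: E0; exists a, r.
  have -> : (F_fun V0 V1 : R -> R) = cst 0 by apply/funext => a; exact: F0.
  exact: cst_continuous.
have En a : E a !=set0.
  move: Ea0 => [u [g [Hu Ku _]]]; have [cu _ _ _ _] := Hu.
  exists (energy V0 V1 (u \o shift (a0 - a)) (g \o shift (a0 - a))).
  exists (u \o shift (a0 - a)), (g \o shift (a0 - a)); split=> //.
    exact: H1_with_deriv_shift.
  by have := K_set_shift a0 (a0 - a) u cu Ku; rewrite subKr.
have Elb a : has_lbound (E a) by exists (- N) => r; exact: E_lb.
have FN a : - N <= F_fun V0 V1 a.
  by rewrite FE; apply: lb_le_inf => // r; exact: E_lb.
(* Adding 1 + N turns r' <= r + C k (1 + N + r) into the multiplicative bound 1 + N + r' <= (1 + C
   k) (1 + N + r), and makes f positive. *)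
pose f (a : R) : R := 1 + N + F_fun V0 V1 a.
have cf : continuous f.
  apply: (continuous_of_sqrt_modulus f C C0) => [a|a b ba].
    by have := FN a; rewrite /f; lra.
  set k := Num.sqrt _; have k0 : 0 <= k by exact: sqrtr_ge0.
  have D0 : 0 < 1 + C * k by rewrite ltr_pwDl// mulr_ge0.
  (* The inequality is solved for the infimum over [E a], so that it suffices to check a lower bound
     on each r in [E a]. *)
  rewrite mulrC -ler_pdivrMr// /f -lerBlDl FE [leRHS]FE.
  apply: lb_le_inf => // r Er; rewrite lerBlDl ler_pdivrMr//.
  have [r' Er' r'r] := E_shift a b r Er ba.
  have Fr' := ge_inf (Elb b) Er'; rewrite -/k in r'r.
  rewrite [leRHS](_ : _ = 1 + N + (r + C * k * (1 + (N + r)))); last by ring.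
  lra.
have -> : (F_fun V0 V1 : R -> R) = (fun a => f a - (1 + N)).
  by apply/funext => a; rewrite /f addrC addKr.
by move=> a; apply: cvgB; [exact: cf|exact: cvg_cst].
Qed.
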